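(* Let $r\in\mathbb{R}$, and let $a_1,a_2,a_3,b_1,b_2,b_3,c_1,c_2,c_3\in\mathbb{C}$ satisfy $$a_2=\bar b_1,\quad b_2=\bar a_1,\quad c_2=\bar c_1,\quad b_3=-\bar a_3,\quad c_3=-\bar c_3 .$$ Consider the complex system $$\frac{dz}{dT}=z(1+a_1z+b_1w+c_1u),\qquad \frac{dw}{dT}=-w(1+a_2z+b_2w+c_2u),\qquad \frac{du}{dT}=u(\mathbf{i}r+a_3z+b_3w+c_3u).$$ The origin of this system (or of its real concomitant system) is an isochronous center on the center manifold if and only if $$b_1(a_1+a_2)=0\quad\text{and}\quad a_2(b_1+b_2)=0,$$ namely, if and only if one of the following four conditions holds: (i) $b_1=b_2=0$; (ii) $a_1=a_2=0$; (iii) $b_1=a_2=0$; (iv) $a_2=-a_1$ and $b_1=-b_2$.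
   Context: Let $\mathbf{i}=\sqrt{-1}$; series are treated as formal power series. Write the right-hand sides of the complex system as $Z(z,w,u)$, $-W(z,w,u)$, $U(z,w,u)$. Real concomitant system: with $z=x+\mathbf{i}y$, $w=x-\mathbf{i}y$, $T=\mathbf{i}t$ ($x,y,u,t$ real) the complex system becomes a real system $\dot x=-y+X_2(x,y,u)$, $\dot y=x+Y_2(x,y,u)$, $\dot u=-ru+U_2(x,y,u)$ with $X_2,Y_2,U_2$ homogeneous quadratic polynomials determined by the coefficients. Reduced complex system: the real system has a center manifold with an expansion $u=u(x,y)=u_2(x,y)+\text{h.o.t.}$, where $u_2$ is a homogeneous quadratic polynomial and h.o.t. denotes terms of order at least 3. Put $\tilde u(z,w)=u\big(\tfrac{z+w}{2},\tfrac{z-w}{2\mathbf{i}}\big)$. The reduced complex system is $\frac{dz}{dT}=Z(z,w,\tilde u(z,w))$, $\frac{dw}{dT}=-W(z,w,\tilde u(z,w))$; it is the complex form of the planar real system obtained by restricting to the center manifold. Isochronous center: for the reduced complex system there are unique formal series $\xi=z+\sum_{k+j\ge2}c_{kj}z^kw^j$, $\eta=w+\sum_{k+j\ge2}d_{kj}w^kz^j$ with $c_{k+1,k}=d_{k+1,k}=0$ for $k\ge1$, and constants $p_j,q_j$, such that along the reduced system $$\frac{d\xi}{dT}=\xi+\sum_{j\ge1}p_j\xi^{j+1}\eta^j,\qquad \frac{d\eta}{dT}=-\eta-\sum_{j\ge1}q_j\eta^{j+1}\xi^j .$$ The origin of the three-dimensional system is called an isochronous center (on the center manifold) if $p_k=q_k=0$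 for all $k\ge1$.
   Formalization: For r=0 the center manifold expansion is not determined by invariance (several invariant surfaces can coexist), so the formal statement fixes it by requiring the coefficients of (zw)^k in ũ to vanish; for r≠0 nothing is changed. *)

(* Defs.v *)
From HB Require Import structures.
From mathcomp Require Import all_boot all_order all_algebra.
From mathcomp Require Import boolp reals complex.

Set Implicit Arguments.
Unset Strict Implicit.
Unset Printing Implicit Defensive.

Import Order.TTheory GRing.Theory Num.Theory.
Local Open Scope ring_scope.

(* Formal power series in two variables: [f k j] is the coefficient of
   [X^k Y^j]. *)
Record fps2 (K : Type) := Fps2 { fps2_coef :> nat -> nat -> K }.
Add Printing Constructor fps2.

Section Fps2Ring.
Variable K : comNzRingType.
Implicit Types f g h : fps2 K.

HB.instance Definition _ := gen_eqMixin (fps2 K).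
HB.instance Definition _ := gen_choiceMixin (fps2 K).

Lemma fps2P f g : (forall k j, f k j = g k j) <-> f = g.
Proof.
split=> [|-> //]; case: f g => [f] [g] /= fg.
by congr Fps2; apply/funext => k; apply/funext => j.
Qed.

Definition fps2_zero : fps2 K := Fps2 (fun _ _ => 0).
Definition fps2_opp f := Fps2 (fun k j => - f k j).
Definition fps2_add f g := Fps2 (fun k j => f k j + g k j).

Fact fps2_addA : associative fps2_add.
Proof. by move=> f g h; apply/fps2P => k j /=; rewrite addrA. Qed.
Fact fps2_addC : commutative fps2_add.
Proof. by move=> f g; apply/fps2P => k j /=; rewrite addrC. Qed.
Fact fps2_add0 : left_id fps2_zero fps2_add.
Proof. by move=> f; apply/fps2P => k j /=; rewrite add0r. Qed.
Fact fps2_addN : left_inverse fps2_zero fps2_opp fps2_add.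
Proof. by move=> f; apply/fps2P => k j /=; rewrite addNr. Qed.

HB.instance Definition _ := GRing.isZmodule.Build (fps2 K)
  fps2_addA fps2_addC fps2_add0 fps2_addN.

Definition fps2_const (c : K) : fps2 K :=
  Fps2 (fun k j => if (k == 0%N) && (j == 0%N) then c else 0).

Definition fps2_mul f g := Fps2 (fun k j =>
  \sum_(m < k.+1) \sum_(n < j.+1) f m n * g (k - m)%N (j - n)%N).

(* Truncation to a bivariate polynomial, used to transfer the ring axioms. *)
Definition fps2_trunc N f : {poly {poly K}} :=
  \poly_(k < N) \poly_(j < N) f k j.

Lemma coef_trunc N f k j : (k < N)%N -> (j < N)%N ->
  (fps2_trunc N f)`_k`_j = f k j.
Proof. by move=> kN jN; rewrite coef_poly kN coef_poly jN. Qed.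

Lemma coef2M (p q : {poly {poly K}}) k j : (p * q)`_k`_j =
  \sum_(m < k.+1) \sum_(n < j.+1) p`_m`_n * q`_(k - m)`_(j - n).
Proof. by rewrite coefM coef_sum; apply: eq_bigr => m _; rewrite coefM. Qed.

Lemma coef_trunc_mul N f g k j : (k < N)%N -> (j < N)%N ->
  (fps2_trunc N f * fps2_trunc N g)`_k`_j = fps2_mul f g k j.
Proof.
move=> kN jN; rewrite coef2M; apply: eq_bigr => m _; apply: eq_bigr => n _.
have lt_sub a b : (a < N)%N -> (a - b < N)%N.
  by apply: leq_ltn_trans; rewrite leq_subr.
have lt_ord a (i : 'I_a.+1) : (a < N)%N -> (i < N)%N.
  by apply: leq_ltn_trans; rewrite -ltnS.
by rewrite !coef_trunc ?lt_sub ?lt_ord.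
Qed.

Fact fps2_mulC : commutative fps2_mul.
Proof.
move=> f g; apply/fps2P => k j; pose N := (k + j).+1.
have kN : (k < N)%N by rewrite ltnS leq_addr.
have jN : (j < N)%N by rewrite ltnS leq_addl.
by rewrite -!(coef_trunc_mul _ _ kN jN) mulrC.
Qed.

Fact fps2_mulA : associative fps2_mul.
Proof.
move=> f g h; apply/fps2P => k j; pose N := (k + j).+1.
have kN : (k < N)%N by rewrite ltnS leq_addr.
have jN : (j < N)%N by rewrite ltnS leq_addl.
have lt_sub a b : (a < N)%N -> (a - b < N)%N.
  by apply: leq_ltn_trans; rewrite leq_subr.
have lt_ord a (m : 'I_a.+1) : (a < N)%N -> (m < N)%N.
  by apply: leq_ltn_trans; rewrite -ltnS.
transitivity ((fps2_trunc N f * (fps2_trunc N g * fps2_trunc N h))`_k`_j).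
  rewrite coef2M; apply: eq_bigr => m _; apply: eq_bigr => n _.
  by rewrite coef_trunc ?lt_ord // coef_trunc_mul ?lt_sub.
rewrite mulrA coef2M; apply: eq_bigr => m _; apply: eq_bigr => n _.
by rewrite (coef_trunc h) ?lt_sub // coef_trunc_mul ?lt_ord.
Qed.

Lemma fps2_constM c f k j : fps2_mul (fps2_const c) f k j = c * f k j.
Proof.
rewrite /= big_ord_recl [X in _ + X]big1 => [|m _].
  rewrite big_ord_recl big1 ?addr0 ?subn0 // => n _.
  by rewrite mul0r.
by rewrite big1 // => n _; rewrite mul0r.
Qed.

Fact fps2_mul1 : left_id (fps2_const 1) fps2_mul.
Proof. by move=> f; apply/fps2P => k j; rewrite fps2_constM mul1r. Qed.
Fact fps2_mulDl : left_distributive fps2_mul fps2_add.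
Proof.
move=> f g h; apply/fps2P => k j /=; rewrite -big_split; apply: eq_bigr => m _.
by rewrite -big_split; apply: eq_bigr => n _; rewrite mulrDl.
Qed.
Fact fps2_oner_neq0 : fps2_const 1 != 0.
Proof.
by apply/eqP => /fps2P /(_ 0 0)%N /= /eqP; rewrite oner_eq0.
Qed.

HB.instance Definition _ := GRing.Zmodule_isComNzRing.Build (fps2 K)
  fps2_mulA fps2_mulC fps2_mul1 fps2_mulDl fps2_oner_neq0.

Definition fps2_scale (c : K) f := Fps2 (fun k j => c * f k j).

Fact fps2_scaleA a b f :
  fps2_scale a (fps2_scale b f) = fps2_scale (a * b) f.
Proof. by apply/fps2P => k j /=; rewrite mulrA. Qed.
Fact fps2_scale1 : left_id 1 fps2_scale.
Proof. by move=> f; apply/fps2P => k j /=; rewrite mul1r. Qed.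
Fact fps2_scaleDr : right_distributive fps2_scale +%R.
Proof. by move=> a f g; apply/fps2P => k j /=; rewrite mulrDr. Qed.
Fact fps2_scaleDl f : {morph fps2_scale^~ f : a b / a + b}.
Proof. by move=> a b; apply/fps2P => k j /=; rewrite mulrDl. Qed.

HB.instance Definition _ := GRing.Zmodule_isLmodule.Build K (fps2 K)
  fps2_scaleA fps2_scale1 fps2_scaleDr fps2_scaleDl.

Fact fps2_scaleAl (a : K) f g : a *: (f * g) = a *: f * g.
Proof.
apply/fps2P => k j /=; rewrite mulr_sumr; apply: eq_bigr => m _.
by rewrite mulr_sumr; apply: eq_bigr => n _; rewrite mulrA.
Qed.

HB.instance Definition _ := GRing.Lmodule_isLalgebra.Build K (fps2 K)
  fps2_scaleAl.
HB.instance Definition _ := GRing.Lalgebra_isComAlgebra.Build K (fps2 K).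

Definition fps2X : fps2 K := Fps2 (fun k j => ((k == 1%N) && (j == 0%N))%:R).
Definition fps2Y : fps2 K := Fps2 (fun k j => ((k == 0%N) && (j == 1%N))%:R).

Definition fps2_dX f := Fps2 (fun k j => f k.+1 j *+ k.+1).
Definition fps2_dY f := Fps2 (fun k j => f k j.+1 *+ j.+1).

(* The substitution [f(g, h)].  It is meaningful only when [g] and [h] have no
   constant term; then [g^m h^n] has order at least [m + n], so the terms with
   [m > k + j] or [n > k + j] do not contribute to the coefficient of
   [X^k Y^j]. *)
Definition fps2_comp f g h := Fps2 (fun k j =>
  \sum_(m < (k + j).+1) \sum_(n < (k + j).+1)
    f m n * (g ^+ m * h ^+ n : fps2 K) k j).

End Fps2Ring.

Arguments fps2X {K}.
Arguments fps2Y {K}.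

(* The complex system dz/dT = Z, dw/dT = - W, du/dT = U.  The polynomial
   right-hand sides are given through their evaluation at series. *)
Record csystem (K : Type) := CSystem {
  rhsZ : fps2 K -> fps2 K -> fps2 K -> fps2 K;
  rhsW : fps2 K -> fps2 K -> fps2 K -> fps2 K;
  rhsU : fps2 K -> fps2 K -> fps2 K -> fps2 K }.

Section Isochronous.
Variable R : realType.
Local Notation C := R[i].
Local Notation I := ('i%C : C).
Implicit Types S : csystem C.

Definition fps2_complex (u : fps2 R) : fps2 C :=
  Fps2 (fun k j => (u k j)%:C%C).

(* z = x + iy and w = x - iy, as series in (x, y) *)
Definition z_of_xy : fps2 C := fps2X + I *: fps2Y.
Definition w_of_xy : fps2 C := fps2X - I *: fps2Y.

(* x = (z + w) / 2 and y = (z - w) / 2i, as series in (z, w) *)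
Definition x_of_zw : fps2 C := 2^-1 *: (fps2X + fps2Y).
Definition y_of_zw : fps2 C := (2 * I)^-1 *: (fps2X - fps2Y).

Definition tilde (u : fps2 R) : fps2 C :=
  fps2_comp (fps2_complex u) x_of_zw y_of_zw.

(* Right-hand sides of the real concomitant system along u = u(x, y).  As
   T = it, one has d/dt = i d/dT; moreover x = (z + w) / 2 and
   y = (z - w) / 2i. *)
Definition zdot S (u : fps2 R) :=
  I *: rhsZ S z_of_xy w_of_xy (fps2_complex u).
Definition wdot S (u : fps2 R) :=
  - (I *: rhsW S z_of_xy w_of_xy (fps2_complex u)).
Definition xdot S (u : fps2 R) := 2^-1 *: (zdot S u + wdot S u).
Definition ydot S (u : fps2 R) := (2 * I)^-1 *: (zdot S u - wdot S u).
Definition udot S (u : fps2 R) :=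
  I *: rhsU S z_of_xy w_of_xy (fps2_complex u).

(* [u] is the formal expansion of the center manifold of a system whose
   u-equation has linear part du/dt = - r u.  The linear part of the invariance
   equation multiplies the coefficient of z^k w^j in [tilde u] by k - j - ir, so
   [u] is determined if r <> 0.  If r = 0 the coefficients of (zw)^k are
   resonant; as in the normal form below, the last clause, void for r <> 0,
   normalizes them to 0. *)
Definition is_center_manifold (r : R) S (u : fps2 R) :=
  [/\ forall k j, (k + j < 2)%N -> u k j = 0,
      fps2_dX (fps2_complex u) * xdot S u + fps2_dY (fps2_complex u) * ydot S u
        = udot S u
    & r = 0 -> forall k, tilde u k k = 0].

(* dF/dT along the planar system dz/dT = Z, dw/dT = - W *)
Definition along (Z W F : fps2 C) := fps2_dX F * Z - fps2_dY F * W.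

(* X + sum_(j >= 1) p_j X^(j+1) Y^j; the value p 0 is not used *)
Definition resonant (p : nat -> C) : fps2 C := Fps2 (fun m n =>
  if m == n.+1 then if n == 0%N then 1 else p n else 0).

(* In the coefficients d_kj of eta the roles of z and w are exchanged:
   d_kj is [eta j k]. *)
Definition is_normal_form (Z W xi eta : fps2 C) (p q : nat -> C) :=
  [/\ [/\ xi 0%N 0%N = 0, xi 1%N 0%N = 1 & xi 0%N 1%N = 0],
      [/\ eta 0%N 0%N = 0, eta 0%N 1%N = 1 & eta 1%N 0%N = 0],
      forall k, (1 <= k)%N -> xi k.+1 k = 0 /\ eta k k.+1 = 0,
      along Z W xi = fps2_comp (resonant p) xi eta
    & along Z W eta = - fps2_comp (resonant q) eta xi].

Definition isochronous_center (r : R) S :=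
  exists2 u, is_center_manifold r S u &
  exists xi eta p q,
    is_normal_form (rhsZ S fps2X fps2Y (tilde u)) (rhsW S fps2X fps2Y (tilde u))
      xi eta p q
    /\ forall k, (1 <= k)%N -> p k = 0 /\ q k = 0.

Definition LV_system (r : R) (a1 a2 a3 b1 b2 b3 c1 c2 c3 : C) : csystem C :=
  CSystem
    (fun z w u => z * (1 + a1 *: z + b1 *: w + c1 *: u))
    (fun z w u => w * (1 + a2 *: z + b2 *: w + c2 *: u))
    (fun z w u => u * ((I * r%:C%C)%:A + a3 *: z + b3 *: w + c3 *: u)).

End Isochronous.

(* Main.v *)
Require Import Defs.
From mathcomp Require Import all_boot all_order all_algebra.
From mathcomp Require Import reals complex.
From mathcomp Require Import ring.

(* The plane u = 0 is invariant, and it is the only (normalized, if r = 0) formal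
   center manifold: in the coordinates z, w the lowest-order part of the invariance equation
   multiplies the coefficient of z^k w^j by k - j - ir.  So the reduced system
   is the planar Lotka-Volterra system, whose first resonant coefficients are
   p_1 = - b1 (a1 + a2) and q_1 = - a2 (b1 + b2); this gives necessity.
   Conversely, as a2 and b1 are conjugate, if both vanish then either
   b1 = a2 = 0 and the equations decouple, or a2 = - a1, b2 = - b1 and the field
   is projective.  Both cases are linearized by explicit quotients z / D and
   w / E.  These may contain resonant monomials (zw)^k z, (zw)^k w, which are
   removed by multiplying the coordinates by series in the first integral
   h = (z / D) (w / E). *)

Set Implicit Arguments.
Unset Strict Implicit.
Unset Printing Implicit Defensive.

Import Order.TTheory GRing.Theory Num.Theory.
Local Open Scope ring_scope.

(** * Formal power series in two variables: coefficients, order, derivations *)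

Section FormalSeries.
Variable K : comNzRingType.
Implicit Types f g h : fps2 K.

Lemma coef2D f g k j : (f + g) k j = f k j + g k j. Proof. by []. Qed.

Lemma coef2N f k j : (- f) k j = - f k j. Proof. by []. Qed.

Lemma coef2Z a f k j : (a *: f) k j = a * f k j. Proof. by []. Qed.

Lemma coef2_1 k j : (1 : fps2 K) k j = ((k == 0%N) && (j == 0%N))%:R.
Proof. by rewrite /GRing.one /=; case: ifP. Qed.

Lemma coef2_sum (I : Type) (r : seq I) (P : pred I) (F : I -> fps2 K) k j :
  (\sum_(i <- r | P i) F i) k j = \sum_(i <- r | P i) F i k j.
Proof. by elim/big_rec2: _ => //= i x y _ <-. Qed.

Lemma coef2XM f k j : (fps2X * f) k j = if k is k'.+1 then f k' j else 0.
Proof.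
rewrite {1}/GRing.mul /=; case: k => [|k].
  by rewrite big_ord1 big1 // => n _; rewrite mul0r.
rewrite big_ord_recl [X in X + _]big1 ?add0r => [|n _]; last by rewrite mul0r.
rewrite big_ord_recl /= [X in _ + X]big1 ?addr0 => [|m _]; last first.
  by rewrite big1 // => n _; rewrite mul0r.
rewrite big_ord_recl /= [X in _ + X]big1 ?addr0 => [|m _]; last first.
  by rewrite mul0r.
by rewrite mul1r subSS !subn0.
Qed.

Lemma coef2YM f k j : (fps2Y * f) k j = if j is j'.+1 then f k j' else 0.
Proof.
rewrite {1}/GRing.mul /= big_ord_recl [X in _ + X]big1 ?addr0 => [|m _]; last first.
  by rewrite big1 // => n _; rewrite mul0r.
rewrite subn0; case: j => [|j].
  by rewrite big_ord1 mul0r.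
rewrite big_ord_recl /= mul0r add0r big_ord_recl /=.
rewrite [X in _ + X]big1 ?addr0 => [|m _]; last by rewrite mul0r.
by rewrite mul1r subSS subn0.
Qed.

Lemma coef2_mono m n k j :
  (fps2X ^+ m * fps2Y ^+ n : fps2 K) k j = ((k == m) && (j == n))%:R.
Proof.
elim: m k => [|m IHm] k; last by rewrite exprS -mulrA coef2XM; case: k.
rewrite expr0 mul1r; elim: n j => [|n IHn] j; first by rewrite coef2_1.
by rewrite exprS coef2YM; case: j => [|j]; rewrite ?andbF.
Qed.

Lemma coef2M00 f g : (f * g) 0%N 0%N = f 0%N 0%N * g 0%N 0%N.
Proof. by rewrite {1}/GRing.mul /= !big_ord1. Qed.

(** Membership in the [n]-th power of the ideal generated by [fps2X] and [fps2Y]. Identities of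
    series are proved modulo every such power, which replaces a topology on series. *)
Definition ordge n f := forall k j, (k + j < n)%N -> f k j = 0.

Lemma ordge_eq0 f : (forall n, ordge n f) -> f = 0.
Proof. by move=> f0; apply/fps2P => k j; apply: (f0 (k + j).+1). Qed.

Lemma ordgeW m n f : (m <= n)%N -> ordge n f -> ordge m f.
Proof. by move=> mn f0 k j kj; apply: f0; apply: leq_trans mn. Qed.

Lemma ordgeD n f g : ordge n f -> ordge n g -> ordge n (f + g).
Proof. by move=> f0 g0 k j kj; rewrite /= f0 ?g0 ?addr0. Qed.

Lemma ordgeN n f : ordge n f -> ordge n (- f).
Proof. by move=> f0 k j kj; rewrite /= f0 ?oppr0. Qed.

Lemma ordgeB n f g : ordge n f -> ordge n g -> ordge n (f - g).
Proof. by move=> f0 g0; apply/ordgeD/ordgeN. Qed.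

Lemma ordgeZ n a f : ordge n f -> ordge n (a *: f).
Proof. by move=> f0 k j kj; rewrite /= f0 ?mulr0. Qed.

Lemma ordgeM m n f g : ordge m f -> ordge n g -> ordge (m + n) (f * g).
Proof.
move=> f0 g0 k j kj; rewrite {1}/GRing.mul /=.
apply: big1 => -[a /= lta] _; apply: big1 => -[b /= ltb] _.
have [abm|mab] := ltnP (a + b) m; first by rewrite f0 ?mul0r.
rewrite g0 ?mulr0 //; rewrite !ltnS in lta ltb.
rewrite -(ltn_add2l m); apply: leq_ltn_trans kj.
by apply: leq_trans (leq_add mab (leqnn _)) _; rewrite addnACA !subnKC.
Qed.

Lemma ordgeMl n f g : ordge n f -> ordge n (f * g).
Proof. by move=> f0; rewrite -[n]addn0; apply: ordgeM. Qed.

Lemma ordgeMr n f g : ordge n g -> ordge n (f * g).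
Proof. by move=> g0; rewrite mulrC; apply: ordgeMl. Qed.

Lemma ordgeX n f m : ordge n f -> ordge (n * m) (f ^+ m).
Proof.
by move=> f0; elim: m => [|m IHm]; rewrite ?muln0 // exprS mulnS; apply: ordgeM.
Qed.

Lemma ordge1 f : f 0%N 0%N = 0 -> ordge 1 f.
Proof. by move=> f0 [|k] [|j]. Qed.

Lemma ordge_fps2X : ordge 1 (fps2X : fps2 K). Proof. exact: ordge1. Qed.
Lemma ordge_fps2Y : ordge 1 (fps2Y : fps2 K). Proof. exact: ordge1. Qed.

(** A series is a finite combination of monomials plus a remainder of order [N]. A property linear
    in the series and known modulo order [N] thus has to be checked on monomials only. *)
Lemma fps2_approx_ind N (P : fps2 K -> Prop) :
    (forall f g, P f -> P g -> P (f + g)) ->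
    (forall a f, P f -> P (a *: f)) ->
    (forall m n, P (fps2X ^+ m * fps2Y ^+ n)) ->
    (forall f, ordge N f -> P f) ->
  forall f, P f.
Proof.
move=> PD PZ Pm PN f.
pose p := \sum_(m < N) \sum_(n < N) f m n *: (fps2X ^+ m * fps2Y ^+ n).
have P0 : P 0 by apply: PN.
have Pp : P p.
  apply: (big_ind P) => // m _; apply: (big_ind P) => // n _.
  exact/PZ/Pm.
rewrite -[f](subrK p); apply: PD Pp; apply: PN => k j kj.
have kN : (k < N)%N by apply: leq_ltn_trans kj; apply: leq_addr.
have jN : (j < N)%N by apply: leq_ltn_trans kj; apply: leq_addl.
rewrite coef2D coef2N coef2_sum (bigD1 (Ordinal kN)) // [X in _ - (_ + X)]big1 => [|i ik].
  rewrite coef2_sum (bigD1 (Ordinal jN)) // [X in _ - (_ + X + _)]big1 => [|i ij].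
    by rewrite coef2Z coef2_mono !eqxx mulr1 !addr0 subrr.
  by rewrite coef2Z coef2_mono eqxx eq_sym (negPf (ij : i != j :> nat)) mulr0.
rewrite coef2_sum big1 // => n _.
by rewrite coef2Z coef2_mono eq_sym (negPf (ik : i != k :> nat)) mulr0.
Qed.

(** The weight [k.+1] of each term of the convolution splits as [m + (k.+1 - m)], one part for each
    factor. *)
Lemma fps2_dX_M f g : fps2_dX (f * g) = fps2_dX f * g + f * fps2_dX g.
Proof.
apply/fps2P => k j; rewrite /= /GRing.mul /=.
transitivity (
  \sum_(m < k.+2) \sum_(n < j.+1) (f m n *+ m * g (k.+1 - m)%N (j - n)%N) +
  \sum_(m < k.+2) \sum_(n < j.+1)
    (f m n * (g (k.+1 - m)%N (j - n)%N *+ (k.+1 - m)))).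
  rewrite -big_split -sumrMnl; apply: eq_bigr => m _.
  rewrite -big_split -sumrMnl; apply: eq_bigr => n _ /=.
  by rewrite mulrnAl mulrnAr -mulrnDr subnKC // -ltnS.
congr (_ + _).
  rewrite big_ord_recl big1 ?add0r => [|n _]; last by rewrite mulr0n mul0r.
  by apply: eq_bigr => m _; apply: eq_bigr => n _; rewrite subSS.
rewrite big_ord_recr /= [X in _ + X]big1 ?addr0 => [|n _]; last first.
  by rewrite subnn mulr0n mulr0.
by apply: eq_bigr => m _; apply: eq_bigr => n _; rewrite subSn // -ltnS.
Qed.

Lemma fps2_dY_M f g : fps2_dY (f * g) = fps2_dY f * g + f * fps2_dY g.
Proof.
apply/fps2P => k j; rewrite /= /GRing.mul /=.
rewrite -sumrMnl -big_split; apply: eq_bigr => m _ /=.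
transitivity (\sum_(n < j.+2) (f m n *+ n * g (k - m)%N (j.+1 - n)%N) +
  \sum_(n < j.+2) (f m n * (g (k - m)%N (j.+1 - n)%N *+ (j.+1 - n)))).
  rewrite -big_split -sumrMnl; apply: eq_bigr => n _ /=.
  by rewrite mulrnAl mulrnAr -mulrnDr subnKC // -ltnS.
congr (_ + _).
  rewrite big_ord_recl mulr0n mul0r add0r.
  by apply: eq_bigr => n _; rewrite subSS.
rewrite big_ord_recr /= subnn mulr0n mulr0 addr0.
by apply: eq_bigr => n _; rewrite subSn // -ltnS.
Qed.

(** The derivative along the vector field with components [A] and [B]. The planar system is the
    instance [der Z (- W)]. *)
Definition der (A B f : fps2 K) := fps2_dX f * A + fps2_dY f * B.

Section Derivation.
Variables A B : fps2 K.
Local Notation D := (der A B).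

Lemma derD f g : D (f + g) = D f + D g.
Proof.
have -> : D (f + g) = (fps2_dX f + fps2_dX g) * A + (fps2_dY f + fps2_dY g) * B.
  by congr (_ * A + _ * B); apply/fps2P => k j; rewrite /= mulrnDl.
by rewrite /der; ring.
Qed.

Lemma derZ a f : D (a *: f) = a *: D f.
Proof.
rewrite /der scalerDr !scalerAl.
by congr (_ * A + _ * B); apply/fps2P => k j; rewrite /= mulrnAr.
Qed.

Lemma derN f : D (- f) = - D f.
Proof. by rewrite -scaleN1r derZ scaleN1r. Qed.

Lemma derM f g : D (f * g) = D f * g + f * D g.
Proof. by rewrite /der fps2_dX_M fps2_dY_M; ring. Qed.

Lemma der1 : D 1 = 0.
Proof.
have dX1 : fps2_dX (1 : fps2 K) = 0.
  by apply/fps2P => k j; rewrite /= mul0rn.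
have dY1 : fps2_dY (1 : fps2 K) = 0.
  by apply/fps2P => k j; rewrite /= andbF mul0rn.
by rewrite /der dX1 dY1 !mul0r addr0.
Qed.

Lemma der_fps2X : D fps2X = A.
Proof.
have dX1 : fps2_dX (fps2X : fps2 K) = 1.
  apply/fps2P => k j; rewrite coef2_1 /= eqSS.
  by case: k => [|k] //=; rewrite mul0rn.
have dY0 : fps2_dY (fps2X : fps2 K) = 0.
  by apply/fps2P => k j; rewrite /= andbF mul0rn.
by rewrite /der dX1 dY0 mul1r mul0r addr0.
Qed.

Lemma der_fps2Y : D fps2Y = B.
Proof.
have dX0 : fps2_dX (fps2Y : fps2 K) = 0.
  by apply/fps2P => k j; rewrite /= mul0rn.
have dY1 : fps2_dY (fps2Y : fps2 K) = 1.
  apply/fps2P => k j; rewrite coef2_1 /= eqSS.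
  by case: j => [|j] //=; rewrite andbF mul0rn.
by rewrite /der dX0 dY1 mul1r mul0r add0r.
Qed.

Lemma derXn f n : D (f ^+ n) = f ^+ n.-1 * D f *+ n.
Proof.
elim: n => [|n IHn]; first by rewrite expr0 der1 mulr0n.
rewrite exprS derM IHn mulrS -mulrnAr mulrA.
case: n {IHn} => [|n]; first by rewrite expr0 !mulr0n !mulr0 mulr1 mul1r.
by rewrite -exprS mulrnAr [D f * _]mulrC.
Qed.

Lemma ordge_der n f : ordge n.+1 f -> ordge n (D f).
Proof.
move=> f0; apply: ordgeD; apply: ordgeMl => k j kj /=.
  by rewrite f0 ?mul0rn // addSn.
by rewrite f0 ?mul0rn // addnS.
Qed.

End Derivation.

(** * Substitution of series without constant term, and the chain rule *)

Section Composition.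
Variables g h : fps2 K.
Local Notation T f := (fps2_comp f g h).

Lemma coef2_comp f k j : T f k j =
  \sum_(m < (k + j).+1) \sum_(n < (k + j).+1) f m n * (g ^+ m * h ^+ n) k j.
Proof. by []. Qed.

Lemma compD f1 f2 : T (f1 + f2) = T f1 + T f2.
Proof.
apply/fps2P => k j; rewrite /= -big_split; apply: eq_bigr => m _.
by rewrite -big_split; apply: eq_bigr => n _; rewrite mulrDl.
Qed.

Lemma compZ a f : T (a *: f) = a *: T f.
Proof.
apply/fps2P => k j; rewrite /= mulr_sumr; apply: eq_bigr => m _.
by rewrite mulr_sumr; apply: eq_bigr => n _; rewrite mulrA.
Qed.

Lemma comp0 : T 0 = 0.
Proof. by rewrite -(scale0r (0 : fps2 K)) compZ !scale0r. Qed.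

Lemma compN f : T (- f) = - T f.
Proof. by rewrite -scaleN1r compZ scaleN1r. Qed.

Lemma compB f1 f2 : T (f1 - f2) = T f1 - T f2.
Proof. by rewrite compD compN. Qed.

Lemma comp00 f : T f 0%N 0%N = f 0%N 0%N.
Proof. by rewrite /= !big_ord1 !expr0 mulr1 coef2_1 mulr1. Qed.

Hypotheses (g0 : ordge 1 g) (h0 : ordge 1 h).

Lemma ordge_mono m n : ordge (m + n) (g ^+ m * h ^+ n).
Proof.
rewrite -[m]mul1n -[n]mul1n.
by apply: ordgeM; rewrite mul1n -[X in ordge X]mul1n; apply: ordgeX.
Qed.

Lemma ordge_comp N f : ordge N f -> ordge N (T f).
Proof.
move=> f0 k j kj; rewrite coef2_comp big1 // => m _; rewrite big1 // => n _.
have [mnN|Nmn] := ltnP (m + n) N; first by rewrite f0 ?mul0r.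
by rewrite ordge_mono ?mulr0 //; apply: leq_trans Nmn.
Qed.

(** If the degree [k + j] is below [m + n], both coefficients vanish by order; otherwise [m] and [n]
    lie within the finite summation range and a single term survives. *)
Lemma comp_mono m n : T (fps2X ^+ m * fps2Y ^+ n) = g ^+ m * h ^+ n.
Proof.
apply/fps2P => k j.
have [kjmn|mnkj] := ltnP (k + j) (m + n).
  rewrite ordge_mono // (_ : T _ k j = 0) //.
  apply: (@ordge_comp (m + n)) => // a b ab; rewrite coef2_mono.
  by case: eqP ab => //= ->; case: eqP => //= ->; rewrite ltnn.
have lem : (m < (k + j).+1)%N by rewrite ltnS (leq_trans (leq_addr n m)).
have len : (n < (k + j).+1)%N by rewrite ltnS (leq_trans (leq_addl m n)).
rewrite coef2_comp (bigD1 (Ordinal lem)) // [X in _ + X = _]big1 => [|i im].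
  rewrite (bigD1 (Ordinal len)) // [X in _ + X + _ = _]big1 => [|i ni].
    by rewrite coef2_mono !eqxx mul1r !addr0.
  by rewrite coef2_mono (negPf (ni : i != n :> nat)) andbF mul0r.
by rewrite big1 // => i' _; rewrite coef2_mono (negPf (im : i != m :> nat)) mul0r.
Qed.

Lemma comp1 : T 1 = 1.
Proof. by have := comp_mono 0 0; rewrite !expr0 !mulr1. Qed.

Lemma compX : T fps2X = g.
Proof. by have := comp_mono 1 0; rewrite !expr0 !mulr1 !expr1. Qed.

Lemma compY : T fps2Y = h.
Proof. by have := comp_mono 0 1; rewrite !expr0 !mul1r !expr1. Qed.

(** The difference of the two sides is bilinear, zero on pairs of monomials, and of order [N] as
    soon as one argument is; approximation is applied to each argument in turn. *)
Lemma compM f1 f2 : T (f1 * f2) = T f1 * T f2.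
Proof.
apply/eqP; rewrite -subr_eq0; apply/eqP/ordge_eq0 => N.
have ordge_l f f' : ordge N f -> ordge N (T (f * f') - T f * T f').
  by move=> f0; apply: ordgeB; [apply/ordge_comp|]; apply: ordgeMl => //;
    apply: ordge_comp.
elim/(@fps2_approx_ind N): f1 f2 => [f f' IHf IHf' f2|a f IHf f2|m n f2|f f0 f2].
- by rewrite mulrDl !compD mulrDl opprD addrACA; apply: ordgeD.
- by rewrite -scalerAl !compZ -scalerAl -scalerBr; apply: ordgeZ.
- elim/(@fps2_approx_ind N): f2 => [f f' IHf IHf'|a f IHf|m' n'|f f0].
  + by rewrite mulrDr !compD mulrDr opprD addrACA; apply: ordgeD.
  + by rewrite -scalerAr !compZ -scalerAr -scalerBr; apply: ordgeZ.
  + by rewrite mulrACA -!exprD !comp_mono mulrACA -!exprD subrr.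
  + by rewrite mulrC [T _ * _]mulrC; apply: ordge_l.
- exact: ordge_l.
Qed.

Lemma der_comp A B f :
  der A B (T f) = T (fps2_dX f) * der A B g + T (fps2_dY f) * der A B h.
Proof.
apply/eqP; rewrite -subr_eq0; apply/eqP/ordge_eq0 => N.
pose dX f := der 1 0 f; pose dY f := der 0 1 f.
have dXE f' : fps2_dX f' = dX f' by rewrite /dX /der mulr1 mulr0 addr0.
have dYE f' : fps2_dY f' = dY f' by rewrite /dY /der mulr1 mulr0 add0r.
rewrite dXE dYE.
(* The remainder is taken of order [N.+1] because differentiation lowers the order by one. *)
elim/(@fps2_approx_ind N.+1): f => [f1 f2 IH1 IH2|a f IHf|m n|f f0].
- rewrite /dX /dY compD !derD (compD (der 1 0 f1)) (compD (der 0 1 f1)).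
  rewrite [X in ordge N X](_ : _ =
    (der A B (T f1) - (T (dX f1) * der A B g + T (dY f1) * der A B h)) +
    (der A B (T f2) - (T (dX f2) * der A B g + T (dY f2) * der A B h))).
    exact: ordgeD.
  by rewrite /dX /dY; ring.
- rewrite /dX /dY !(derZ, compZ) -!scalerAl -scalerDr -scalerBr.
  exact: ordgeZ.
- rewrite comp_mono /dX /dY !(derM, derXn, der_fps2X, der_fps2Y).
  rewrite !(mulr1, mulr0, mul0rn, mul0r, addr0, add0r).
  rewrite !(mulrnAl, mulrnAr) -!scaler_nat !compZ !comp_mono -!scalerAl.
  rewrite [X in ordge N X](_ : _ = 0) //.
  by rewrite mulrAC mulrA subrr.
- apply: ordgeB; first by apply/ordge_der/ordge_comp.
  by apply: ordgeD; apply/ordgeMl/ordge_comp/ordge_der.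
Qed.

End Composition.
End FormalSeries.

(** * Series in a first integral and removal of resonant monomials *)

Section Linearization.
Variable K : comNzRingType.
Implicit Types f g h L M : fps2 K.

Lemma ordge_der_quadratic A B n f : ordge 2 A -> ordge 2 B -> ordge n f ->
  ordge n.+1 (der A B f).
Proof.
move=> A2 B2 f0; rewrite -addn1; apply: ordgeD; case: n f0 => [|n] f0.
- by apply: ordgeMr; apply: ordgeW A2.
- rewrite addSnnS; apply: ordgeM => // k j kj.
  by rewrite /= f0 ?mul0rn // addSn.
- by apply: ordgeMr; apply: ordgeW B2.
- rewrite addSnnS; apply: ordgeM => // k j kj.
  by rewrite /= f0 ?mul0rn // addnS.
Qed.

(** A one-variable series is encoded as a two-variable series free of [fps2Y], so that substitution
    into it inherits the chain rule of [fps2_comp]. *)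
Definition uni (c : nat -> K) : fps2 K :=
  Fps2 (fun k j => if j == 0%N then c k else 0).

Definition usubst (c : nat -> K) h := fps2_comp (uni c) h 0.

Lemma usubst00 c h : usubst c h 0%N 0%N = c 0%N.
Proof. exact: comp00. Qed.

Lemma usubstS c h : ordge 1 h ->
  usubst c h = c 0%N *: 1 + h * usubst (fun n => c n.+1) h.
Proof.
move=> h0; have z0 : ordge 1 (0 : fps2 K) by [].
have -> : usubst c h = fps2_comp (c 0%N *: 1 + fps2X * uni (c \o succn)) h 0.
  congr fps2_comp; apply/fps2P => k j.
  rewrite coef2D coef2Z coef2_1 coef2XM; case: k => [|k] /=; last by rewrite mulr0 add0r.
  by case: eqP; rewrite ?mulr1 ?mulr0 addr0.
by rewrite compD compZ comp1 // compM // compX.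
Qed.

Lemma usubst_approx c h n : ordge 1 h -> usubst c h =
  \sum_(m < n) c m *: h ^+ m + h ^+ n * usubst (fun k => c (n + k)%N) h.
Proof.
move=> h0; elim: n c => [|n IHn] c; first by rewrite big_ord0 add0r mul1r.
rewrite IHn (usubstS (fun k => c (n + k)%N)) // big_ord_recr /= addn0.
rewrite mulrDr -scalerAr mulr1 addrA mulrA -exprSr; congr (_ + _ * _).
by congr usubst; apply/boolp.funext => k; rewrite addnS.
Qed.

(** The inverse is the geometric series in [1 - f], which has no constant term. *)
Lemma fps2_inv f : f 0%N 0%N = 1 ->
  exists2 g : fps2 K, g 0%N 0%N = 1 & f * g = 1.
Proof.
move=> f1; exists (usubst (fun _ => 1) (1 - f)); first by rewrite usubst00.
have h0 : ordge 1 (1 - f) by apply: ordge1; rewrite /= f1 subrr.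
have := usubstS (fun _ => 1) h0; rewrite scale1r; set g := usubst _ _ => gE.
have -> : f * g = g - (1 - f) * g by ring.
by rewrite {1}gE addrK.
Qed.

Lemma lead_mul m n f f' g g' : ordge m f' -> ordge n g ->
  ordge m.+1 (f - f') -> ordge n.+1 (g - g') ->
  ordge (m + n).+1 (f * g - f' * g').
Proof.
move=> f0 g0 ff gg.
have -> : f * g - f' * g' = (f - f') * g + f' * (g - g') by ring.
by apply: ordgeD; [rewrite -addSn|rewrite -addnS]; apply: ordgeM.
Qed.

Lemma triangular_system (c : nat -> nat -> K) : exists2 phi : nat -> K,
  phi 0%N = 1 & forall k, (0 < k)%N -> \sum_(m < k) phi m * c m k + phi k = 0.
Proof.
(* The list [s n] holds the first [n] values of the solution; the empty list is extended by the
   initial value 1. *)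
pose next s := rcons s (if s is [::] then 1 else
  - \sum_(m < size s) nth 0 s m * c m (size s)).
pose s n := iter n next [::].
have size_s n : size (s n) = n by elim: n => //= n IHn; rewrite size_rcons IHn.
have nth_s m n : (m < n)%N -> nth 0 (s n) m = nth 0 (s m.+1) m.
  elim: n => // n IHn; rewrite ltnS leq_eqVlt => /predU1P[->//|mn].
  by rewrite -IHn // /s iterS {1}/next nth_rcons size_s mn.
exists (fun k => nth 0 (s k.+1) k) => // k k_gt0.
rewrite [X in _ + X](_ : _ = - \sum_(m < k) nth 0 (s k) m * c m k).
  by apply/eqP; rewrite subr_eq0; apply/eqP/eq_bigr => m _; rewrite nth_s.
rewrite /s iterS -/(s k) {1}/next nth_rcons size_s ltnn eqxx.
by case: (s k) (size_s k) k_gt0 => // <-.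
Qed.

(* [G] is a series in the first integral [h], so [zeta * G] satisfies the same
   linear equation as [zeta]; its coefficients are found from a triangular
   system. *)
Lemma resonant_normalization A B (zeta : fps2 K) h a b : der A B h = 0 ->
    ordge 3 (h - fps2X * fps2Y) ->
    ordge (a + b).+1 (zeta - fps2X ^+ a * fps2Y ^+ b) ->
  exists G : fps2 K, [/\ G 0%N 0%N = 1, der A B G = 0 &
    forall k, (0 < k)%N -> (zeta * G) (k + a)%N (k + b)%N = 0].
Proof.
move=> Dh hXY zetaXY.
have XY2 : ordge 2 (fps2X * fps2Y : fps2 K).
  by apply: (@ordgeM K 1 1); [apply: ordge_fps2X|apply: ordge_fps2Y].
have h2 : ordge 2 h.
  by rewrite -[h](subrK (fps2X * fps2Y)); apply: ordgeD XY2; apply: ordgeW hXY.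
have h1 : ordge 1 h by apply: ordgeW h2.
have ordge_XY m : ordge (a + b + 2 * m)
    (fps2X ^+ (a + m) * fps2Y ^+ (b + m) : fps2 K).
  rewrite mul2n -addnn addnACA.
  by apply: ordge_mono; [apply: ordge_fps2X|apply: ordge_fps2Y].
(* The lowest-order part of [zeta * h ^+ m] is exactly the [m]-th resonant monomial, which makes the
   system for the coefficients of [G] unitriangular. *)
have lead_zh m : ordge (a + b + 2 * m).+1
    (zeta * h ^+ m - fps2X ^+ (a + m) * fps2Y ^+ (b + m)).
  elim: m => [|m IHm]; first by rewrite expr0 mulr1 !addn0.
  rewrite (addnS a) (addnS b) !exprSr mulrA mulrACA.
  rewrite mulnS [(2 + _)%N]addnC addnA.
  by apply: lead_mul => //; apply: ordge_XY.
have zh m : ordge (a + b + 2 * m) (zeta * h ^+ m).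
  rewrite -[zeta * _](subrK (fps2X ^+ (a + m) * fps2Y ^+ (b + m))).
  apply: ordgeD; first exact: ordgeW (lead_zh m).
  exact: ordge_XY.
have [phi phi0 phiS] := triangular_system
  (fun m k => (zeta * h ^+ m) (k + a)%N (k + b)%N).
exists (usubst phi h); split; first by rewrite usubst00.
  (* The chain rule leaves only the derivative of the second substituted series, which is 0. *)
  rewrite der_comp // Dh mulr0 add0r -(scale0r 0) derZ !scale0r mulr0.
  by [].
move=> k k_gt0; rewrite (usubst_approx phi k.+1 h1) mulrDr coef2D.
have kakb : (k + a + (k + b) = a + b + 2 * k)%N by rewrite addnACA addnn mul2n addnC.
(* The tail beyond [h ^+ k] has order at least [a + b + 2 * k.+1], above the degree of the
   coefficient considered. *)
rewrite mulrA [X in _ + X](ordgeMl _ (zh k.+1)) ?addr0; last first.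
  by rewrite kakb ltn_add2l ltn_pmul2l.
rewrite mulr_sumr coef2_sum.
under eq_bigr => m _ do rewrite -scalerAr coef2Z.
rewrite big_ord_recr -[RHS](phiS k k_gt0); congr (_ + _).
have := lead_zh k (k + a)%N (k + b)%N; rewrite kakb => /(_ (leqnn _)).
rewrite coef2D coef2N coef2_mono ![(k + _)%N]addnC !eqxx => /eqP.
by rewrite subr_eq0 => /eqP /= ->; rewrite mulr1.
Qed.

End Linearization.

(** * The planar Lotka-Volterra field: resonance obstructions and linearization *)

Section LotkaVolterra.
Variable K : comNzRingType.
Implicit Types f g h A B D E G L M : fps2 K.

Definition LVfactor (c d : K) : fps2 K := 1 + c *: fps2X + d *: fps2Y.

Lemma derXMYM L M f :
  der (fps2X * L) (- (fps2Y * M)) f = fps2X * fps2_dX f * L - fps2Y * fps2_dY f * M.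
Proof. by rewrite /der; ring. Qed.

(** The field is a combination of the Euler operators [fps2X * fps2_dX f] and [fps2Y * fps2_dY f],
    which are diagonal on monomials; the factors [fps2X] and [fps2Y] in front only shift indices. *)
Lemma coef2_der_LV a1 a2 b1 b2 f k j :
  der (fps2X * LVfactor a1 b1) (- (fps2Y * LVfactor a2 b2)) f k j =
    (k%:R - j%:R) * f k j +
    (if k is k'.+1 then (a1 * k'%:R - a2 * j%:R) * f k' j else 0) +
    (if j is j'.+1 then (b1 * k%:R - b2 * j'%:R) * f k j' else 0).
Proof.
have -> : der (fps2X * LVfactor a1 b1) (- (fps2Y * LVfactor a2 b2)) f =
    fps2X * fps2_dX f - fps2Y * fps2_dY f
    + fps2X * (a1 *: (fps2X * fps2_dX f) - a2 *: (fps2Y * fps2_dY f))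
    + fps2Y * (b1 *: (fps2X * fps2_dX f) - b2 *: (fps2Y * fps2_dY f)).
  (* Scalars become constant series so that [ring] applies. *)
  have scaleE c (p : fps2 K) : c *: p = c%:A * p by rewrite mulr_algl.
  rewrite derXMYM /LVfactor !(scaleE _ fps2X, scaleE _ fps2Y) !(scaleE _ (_ * _)).
  by move: a1%:A b1%:A a2%:A b2%:A => a b c d; ring.
have XdX m n : (fps2X * fps2_dX f) m n = m%:R * f m n.
  by rewrite coef2XM; case: m => [|m] /=; rewrite ?mul0r // mulr_natl.
have YdY m n : (fps2Y * fps2_dY f) m n = n%:R * f m n.
  by rewrite coef2YM; case: n => [|n] /=; rewrite ?mul0r // mulr_natl.
rewrite !coef2D coef2N (coef2XM (_ - _)) (coef2YM (_ - _)) XdX YdY -mulrBl.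
congr (_ + _ + _).
  by case: k => // k; rewrite coef2D coef2N !coef2Z XdX YdY; ring.
by case: j => // j; rewrite coef2D coef2N !coef2Z XdX YdY; ring.
Qed.

(** The coefficients at (2, 0) and (1, 1) are forced. At (2, 1) the eigenvalue [2 - 1] equals that
    of [xi], so the unknown coefficient cancels and a condition on the parameters remains. *)
Lemma LV_resonance_xi a1 a2 b1 b2 (xi : fps2 K) :
    xi 0%N 1%N = 0 -> xi 1%N 0%N = 1 ->
    der (fps2X * LVfactor a1 b1) (- (fps2Y * LVfactor a2 b2)) xi = xi ->
  b1 * (a1 + a2) = 0.
Proof.
move=> xi01 xi10 E.
have e20 := coef2_der_LV a1 a2 b1 b2 xi 2 0.
have e11 := coef2_der_LV a1 a2 b1 b2 xi 1 1.
have e21 := coef2_der_LV a1 a2 b1 b2 xi 2 1.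
rewrite E xi10 in e20; rewrite E xi10 xi01 in e11; rewrite E in e21.
have {}e20 : xi 2%N 0%N = - a1.
  (* Writing the coefficient as a difference lets [e20] replace its second copy only, which solves
     the equation without dividing. *)
  have -> : xi 2%N 0%N = 2 * xi 2 0 - xi 2 0 by ring.
  by rewrite [X in _ - X]e20; ring.
have {}e11 : xi 1%N 1%N = b1 by rewrite e11; ring.
rewrite e20 e11 in e21.
have -> : b1 * (a1 + a2) = xi 2%N 1%N - ((2%:R - 1%:R) * xi 2 1 +
    (a1 * 1%:R - a2 * 1%:R) * b1 + (b1 * 2%:R - b2 * 0%:R) * - a1) by ring.
by rewrite -e21 subrr.
Qed.

(** The mirror computation: (0, 2) and (1, 1) are forced, and (1, 2) is resonant with eigenvalue
    [1 - 2]. *)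
Lemma LV_resonance_eta a1 a2 b1 b2 (eta : fps2 K) :
    eta 0%N 1%N = 1 -> eta 1%N 0%N = 0 ->
    der (fps2X * LVfactor a1 b1) (- (fps2Y * LVfactor a2 b2)) eta = - eta ->
  a2 * (b1 + b2) = 0.
Proof.
move=> eta01 eta10 E.
have e02 := coef2_der_LV a1 a2 b1 b2 eta 0 2.
have e11 := coef2_der_LV a1 a2 b1 b2 eta 1 1.
have e12 := coef2_der_LV a1 a2 b1 b2 eta 1 2.
rewrite E coef2N in e02; rewrite E coef2N in e11; rewrite E coef2N in e12.
rewrite eta01 in e02; rewrite eta10 eta01 in e11.
have {}e02 : eta 0%N 2%N = - b2.
  have -> : eta 0%N 2%N = - eta 0%N 2%N + 2 * eta 0 2 by ring.
  by rewrite e02; ring.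
have {}e11 : eta 1%N 1%N = a2 by rewrite -[LHS]opprK e11; ring.
rewrite e02 e11 in e12.
have -> : a2 * (b1 + b2) = (1%:R - 2%:R) * eta 1 2 +
    (a1 * 0%:R - a2 * 2%:R) * - b2 + (b1 * 1%:R - b2 * 1%:R) * a2 + eta 1%N 2%N by ring.
by rewrite -e12 addNr.
Qed.

(** Differentiating [D * G = 1] shows that the inverse of a series with cofactor [L] has cofactor
    [- L]. *)
Lemma der_inv A B L D : D 0%N 0%N = 1 -> der A B D = L * D ->
  exists2 G : fps2 K, G 0%N 0%N = 1 & der A B G = - (L * G).
Proof.
move=> D1 DL; have [G G1 DG] := fps2_inv D1; exists G => //.
have := derM A B D G; rewrite DG der1 DL => e.
have -> : der A B G = D * G * der A B G by rewrite DG mul1r.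
have -> : D * G * der A B G = G * (L * D * G + D * der A B G) - L * (D * G) * G.
  by ring.
by rewrite -e DG mulr0 mulr1 sub0r.
Qed.

Lemma fps2_leadX G : G 0%N 0%N = 1 -> ordge 2 (fps2X * G - fps2X).
Proof.
move=> G1; rewrite -[X in _ - X]mulr1 -mulrBr.
by apply: (@ordgeM K 1 1); [apply: ordge_fps2X|apply: ordge1; rewrite /= G1 subrr].
Qed.

Lemma fps2_leadY G : G 0%N 0%N = 1 -> ordge 2 (fps2Y * G - fps2Y).
Proof.
move=> G1; rewrite -[X in _ - X]mulr1 -mulrBr.
by apply: (@ordgeM K 1 1); [apply: ordge_fps2Y|apply: ordge1; rewrite /= G1 subrr].
Qed.

Definition linearizable Z W := exists xi eta : fps2 K,
  [/\ ordge 2 (xi - fps2X), ordge 2 (eta - fps2Y),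
      forall k, (0 < k)%N -> xi k.+1 k = 0 /\ eta k k.+1 = 0,
      der Z (- W) xi = xi & der Z (- W) eta = - eta].

(** Dividing the coordinates by [D] and [E] cancels the cofactors [L] and [- M], leaving the
    constant rates 1 and -1. *)
Lemma LV_linearization L M D E (Z := fps2X * (1 + L)) (W := fps2Y * (1 + M)) :
    D 0%N 0%N = 1 -> der Z (- W) D = L * D ->
    E 0%N 0%N = 1 -> der Z (- W) E = - M * E ->
  linearizable Z W.
Proof.
move=> D1 DD E1 DE.
have [F F1 DF] := der_inv D1 DD; have [G G1 DG] := der_inv E1 DE.
set xi := fps2X * F; set eta := fps2Y * G.
have Dxi : der Z (- W) xi = xi by rewrite /xi derM der_fps2X DF /Z; ring.
have Deta : der Z (- W) eta = - eta by rewrite /eta derM der_fps2Y DG /W; ring.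
have lxi : ordge 2 (xi - fps2X) by apply: fps2_leadX.
have leta : ordge 2 (eta - fps2Y) by apply: fps2_leadY.
have eta1 : ordge 1 eta by apply/ordgeMl/ordge_fps2Y.
have Dh : der Z (- W) (xi * eta) = 0 by rewrite derM Dxi Deta; ring.
have lh : ordge 3 (xi * eta - fps2X * fps2Y).
  by apply: (@lead_mul K 1 1) => //; apply: ordge_fps2X.
have lxi' : ordge 2 (xi - fps2X ^+ 1 * fps2Y ^+ 0) by rewrite expr1 mulr1.
have leta' : ordge 2 (eta - fps2X ^+ 0 * fps2Y ^+ 1) by rewrite expr1 mul1r.
(* The exponents (1, 0) and (0, 1) are those of the leading monomials of [xi] and [eta]. Since [P]
   and [Q] have zero derivative, multiplying by them preserves both rates. *)
have [P [P1 DP Pxi]] := @resonant_normalization K Z (- W) xi _ 1 0 Dh lh lxi'.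
have [Q [Q1 DQ Qeta]] := @resonant_normalization K Z (- W) eta _ 0 1 Dh lh leta'.
exists (xi * P), (eta * Q); split.
- by rewrite /xi -mulrA; apply: fps2_leadX; rewrite coef2M00 F1 P1 mul1r.
- by rewrite /eta -mulrA; apply: fps2_leadY; rewrite coef2M00 G1 Q1 mul1r.
- move=> k k0; have := Pxi k k0; have := Qeta k k0.
  by rewrite !addn0 !addn1.
- by rewrite derM Dxi DP mulr0 addr0.
- by rewrite derM Deta DQ mulr0 addr0 mulNr.
Qed.

Lemma derLV (Z W : fps2 K) a b :
  der Z W (LVfactor a b) = a%:A * Z + b%:A * W.
Proof. by rewrite !derD !derZ der_fps2X der_fps2Y der1 add0r !mulr_algl. Qed.

Lemma LVfactorE a b : LVfactor a b = 1 + (a%:A * fps2X + b%:A * fps2Y).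
Proof. by rewrite !mulr_algl addrA. Qed.

Lemma LVfactor00 a b : LVfactor a b 0%N 0%N = 1.
Proof. by rewrite /= !mulr0 !addr0. Qed.

(** The lines [1 + a z = 0] and [1 + b w = 0] are invariant, with cofactors [a z] and [- b w]. *)
Lemma LV_linearization_decoupled a b :
  linearizable (fps2X * LVfactor a 0) (fps2Y * LVfactor 0 b).
Proof.
rewrite !LVfactorE.
apply: (@LV_linearization _ _ (LVfactor a 0) (LVfactor 0 b)); rewrite ?LVfactor00 //.
  by rewrite derLV LVfactorE scale0r; ring.
by rewrite derLV LVfactorE scale0r; ring.
Qed.

(* The field is projective, and [1 + a z - b w = 0] is an invariant line with
   cofactor [a z + b w]. *)
Lemma LV_linearization_projective a b :
  linearizable (fps2X * LVfactor a b) (fps2Y * LVfactor (- a) (- b)).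
Proof.
rewrite (LVfactorE a b) (LVfactorE (- a)).
apply: (@LV_linearization _ _ (LVfactor a (- b)) (LVfactor a (- b)));
  rewrite ?LVfactor00 // derLV LVfactorE !scaleNr; move: a%:A b%:A => c d; ring.
Qed.

End LotkaVolterra.

(** * Uniqueness of the formal center manifold and reduction to the plane *)

Section CenterManifold.
Variable R : realType.
Local Notation C := R[i].
Local Notation I := ('i%C : C).

Lemma alongE (Z W F : fps2 C) : along Z W F = der Z (- W) F.
Proof. by rewrite /along /der mulrN. Qed.

Lemma ordge_x_of_zw : ordge 1 (x_of_zw R).
Proof. by apply: ordge1; rewrite /= addr0 mulr0. Qed.

Lemma ordge_y_of_zw : ordge 1 (y_of_zw R).
Proof. by apply: ordge1; rewrite /= subr0 mulr0. Qed.

Lemma two_neq0 : 2 != 0 :> C. Proof. by rewrite pnatr_eq0. Qed.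

Lemma mulI2I : I * (2 * I)^-1 = 2^-1.
Proof. by rewrite invfM mulrCA divff ?mulr1 // neq0Ci. Qed.

Lemma comp_z_of_xy : fps2_comp (z_of_xy R) (x_of_zw R) (y_of_zw R) = fps2X.
Proof.
have x1 := ordge_x_of_zw; have y1 := ordge_y_of_zw.
rewrite /z_of_xy compD compZ compX // compY // /x_of_zw /y_of_zw scalerA mulI2I.
rewrite -scalerDr addrACA subrr addr0 -mulr2n -[fps2X *+ 2](@scaler_nat C) scalerA.
by rewrite mulVf ?two_neq0 // scale1r.
Qed.

Lemma comp_w_of_xy : fps2_comp (w_of_xy R) (x_of_zw R) (y_of_zw R) = fps2Y.
Proof.
have x1 := ordge_x_of_zw; have y1 := ordge_y_of_zw.
rewrite /w_of_xy compB compZ compX // compY // /x_of_zw /y_of_zw scalerA mulI2I.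
rewrite -scalerBr opprB [fps2X + _]addrC addrACA subrr addr0.
rewrite -mulr2n -[fps2Y *+ 2](@scaler_nat C) scalerA.
by rewrite mulVf ?two_neq0 // scale1r.
Qed.

(** Substituting the linear change of variables turns the real invariance equation into the complex
    one; the common factor [I], coming from [T = it], cancels. *)
Lemma along_tilde S (u : fps2 R) :
    let T f := fps2_comp f (x_of_zw R) (y_of_zw R) in
    fps2_dX (fps2_complex u) * xdot S u + fps2_dY (fps2_complex u) * ydot S u
      = udot S u ->
  along (T (rhsZ S (z_of_xy R) (w_of_xy R) (fps2_complex u)))
        (T (rhsW S (z_of_xy R) (w_of_xy R) (fps2_complex u))) (tilde u)
    = T (rhsU S (z_of_xy R) (w_of_xy R) (fps2_complex u)).
Proof.
move=> T; have x1 := ordge_x_of_zw; have y1 := ordge_y_of_zw.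
have TB f g : T (f - g) = T f - T g by apply: compB.
have TD f g : T (f + g) = T f + T g by apply: compD.
have TN f : T (- f) = - T f by apply: compN.
have TZ a f : T (a *: f) = a *: T f by apply: compZ.
have TM f g : T (f * g) = T f * T g by apply: compM.
rewrite /xdot /ydot /udot /zdot /wdot => /(congr1 T).
rewrite !(TD, TM, TZ, TB, TN).
set Z := T (rhsZ _ _ _ _); set W := T (rhsW _ _ _ _); set U := T (rhsU _ _ _ _).
rewrite alongE /tilde der_comp // /x_of_zw /y_of_zw !(derZ, derD, der_fps2X, der_fps2Y).
rewrite opprK derN der_fps2Y opprK -[I *: Z - _]scalerBr -[I *: Z + _]scalerDr.
have scI c (f : fps2 C) : c *: (I *: f) = I *: (c *: f).
  by rewrite !scalerA mulrC.
rewrite (scI 2^-1) (scI (2 * I)^-1) -!scalerAr -scalerDr.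
by move=> /(congr1 ( *:%R I^-1)); rewrite !(scalerA I^-1) mulVf ?neq0Ci // !scale1r.
Qed.

Lemma eigenvalue_neq0 (r : R) (k j : nat) : (r = 0 -> k <> j) ->
  k%:R - j%:R - I * r%:C%C != 0 :> C.
Proof.
move=> rkj; apply/negP => /eqP e.
have r0 : r = 0.
  (* The imaginary part of the eigenvalue is [- r]. *)
  have := congr1 (@complex.Im R) e.
  rewrite -!(rmorph_nat (real_complex R)) /=.
  by move=> h; rewrite -[LHS]opprK -[RHS]opprK oppr0 -h; ring.
apply: (rkj r0); move/eqP: e; rewrite r0 mulr0 subr0 subr_eq0 eqr_nat.
by move/eqP.
Qed.

(** Induction on the order [n] of [V]: in degree [n] only the diagonal linear part acts, and its
    eigenvalue is nonzero except at the coefficients normalized to 0. *)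
Lemma invariant_series_eq0 r (P Q S V : fps2 C) :
    ordge 1 P -> ordge 1 Q -> ordge 1 S ->
    der (fps2X * (1 + P)) (- (fps2Y * (1 + Q))) V = V * ((I * r%:C%C)%:A + S) ->
    (r = 0 -> forall k, V k k = 0) ->
  V = 0.
Proof.
move=> P1 Q1 S1 E res; apply: ordge_eq0; elim=> [|n IHn] // k j.
rewrite ltnS leq_eqVlt => /predU1P[kjn|]; last exact: IHn.
have [/andP[/eqP r0 /eqP <-]|rn0] := boolP ((r == 0) && (k == j)).
  exact: res.
have ev : k%:R - j%:R - I * r%:C%C != 0 :> C.
  by apply: eigenvalue_neq0 => r0 kj; rewrite r0 kj !eqxx in rn0.
have lin : fps2X * fps2_dX V - fps2Y * fps2_dY V - (I * r%:C%C) *: V =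
    V * S - der (fps2X * P) (- (fps2Y * Q)) V.
  rewrite -[RHS]add0r -(subrr (V * ((I * r%:C%C)%:A + S))) -{1}E.
  by rewrite -(mulr_algl _ V) /der; move: _%:A => e; ring.
(* The nonlinear terms raise the order of [V] by one, so they are invisible in degree [n]. *)
have high : ordge n.+1 (V * S - der (fps2X * P) (- (fps2Y * Q)) V).
  apply: ordgeB; first by rewrite -addn1; apply: ordgeM.
  apply: ordge_der_quadratic => //; last apply: ordgeN.
    by apply: (@ordgeM C 1 1) => //; apply: ordge_fps2X.
  by apply: (@ordgeM C 1 1) => //; apply: ordge_fps2Y.
have := high k j; rewrite -lin kjn => /(_ (leqnn _)).
rewrite !coef2D !coef2N coef2XM coef2YM coef2Z.
have -> : (if k is k'.+1 then fps2_dX V k' j else 0) = k%:R * V k j.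
  by case: (k) => [|k'] /=; rewrite ?mul0r // mulr_natl.
have -> : (if j is j'.+1 then fps2_dY V k j' else 0) = j%:R * V k j.
  by case: (j) => [|j'] /=; rewrite ?mul0r // mulr_natl.
by rewrite -!mulrBl => /eqP; rewrite mulf_eq0 (negPf ev) => /eqP.
Qed.

(** The occurrences of [tilde u] inside the three factors count as perturbations of positive order;
    the invariance equation is then linear and homogeneous in the remaining ones. *)
Lemma tilde_center_manifold r a1 a2 a3 b1 b2 b3 c1 c2 c3 (u : fps2 R) :
    is_center_manifold r (LV_system r a1 a2 a3 b1 b2 b3 c1 c2 c3) u ->
  tilde u = 0.
Proof.
case=> u2 /along_tilde E res; rewrite /= -/(tilde u) in E.
have x1 := ordge_x_of_zw; have y1 := ordge_y_of_zw.
have X1 := @ordge_fps2X C; have Y1 := @ordge_fps2Y C.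
set V := tilde u in E res *.
have V1 : ordge 1 V.
  by apply: ordge_comp => // k j kj; rewrite /= u2 // ltnW.
move: E; rewrite !(compM, compD, compZ, comp1, comp_z_of_xy, comp_w_of_xy) //.
rewrite -/(tilde u) -/V alongE => E.
have lin1 (a b c : C) : ordge 1 (a *: fps2X + b *: fps2Y + c *: V).
  by apply: ordgeD; first apply: ordgeD; apply: ordgeZ.
apply: (invariant_series_eq0 (lin1 a1 b1 c1) (lin1 a2 b2 c2) (lin1 a3 b3 c3) _ res).
by rewrite !addrA.
Qed.

Lemma center_manifold0 r a1 a2 a3 b1 b2 b3 c1 c2 c3 :
  is_center_manifold r (LV_system r a1 a2 a3 b1 b2 b3 c1 c2 c3) (0 : fps2 R).
Proof.
have c0 : fps2_complex (0 : fps2 R) = 0 by apply/fps2P.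
have d0 A B : der A B (0 : fps2 C) = 0.
  by rewrite -(scale0r (0 : fps2 C)) derZ !scale0r.
split=> //; last by move=> _ k; rewrite /tilde c0 comp0.
by rewrite c0 -/(der _ _ 0) d0 /udot /= c0 mul0r scaler0.
Qed.

Lemma resonant_eq (p : nat -> C) : (forall k, (0 < k)%N -> p k = 0) ->
  resonant p = fps2X.
Proof.
move=> p0; apply/fps2P => -[|m] [|n] //=; rewrite ?eqSS ?andbF //.
  by case: eqP.
by rewrite p0 // if_same.
Qed.

(** As [tilde u] vanishes, the [c] coefficients disappear; with [p] and [q] zero from index 1 on,
    both resonant series reduce to [fps2X] and the normal form becomes linear. *)
Lemma isochronous_LVP r a1 a2 a3 b1 b2 b3 c1 c2 c3
    (Z := fps2X * LVfactor a1 b1 : fps2 C) (W := fps2Y * LVfactor a2 b2 : fps2 C) :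
  isochronous_center r (LV_system r a1 a2 a3 b1 b2 b3 c1 c2 c3) <->
  linearizable Z W.
Proof.
have lead (f g : fps2 C) : ordge 2 (f - g) <->
    [/\ f 0%N 0%N = g 0%N 0%N, f 1%N 0%N = g 1%N 0%N & f 0%N 1%N = g 0%N 1%N].
  split=> [fg|[f00 f10 f01]].
    by split; apply/eqP; rewrite -subr_eq0 -coef2N -coef2D fg.
  by case=> [|[|k]] [|[|j]] // _; rewrite coef2D coef2N ?f00 ?f10 ?f01 subrr.
split.
  case=> u /tilde_center_manifold /= -> [xi [eta [p [q [nf pq0]]]]].
  move: nf; rewrite /= !scaler0 !addr0 -/(LVfactor a1 b1) -/(LVfactor a2 b2) -/Z -/W.
  rewrite /is_normal_form !alongE.
  case=> -[xi00 xi10 xi01] [eta00 eta01 eta10] nf.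
  have -> : resonant p = fps2X by apply: resonant_eq => k /pq0[].
  have -> : resonant q = fps2X by apply: resonant_eq => k /pq0[].
  rewrite !compX; try exact: ordge1.
  by exists xi, eta; split=> //; apply/lead;
    rewrite ?xi00 ?eta00 ?xi10 ?xi01 ?eta10 ?eta01.
case=> xi [eta [/lead[/= xi00 xi10 xi01] /lead[/= eta00 eta10 eta01] nf Dxi Deta]].
exists 0; first exact: center_manifold0.
exists xi, eta, (fun=> 0), (fun=> 0); split=> //.
have -> : tilde (0 : fps2 R) = 0.
  by rewrite /tilde (_ : fps2_complex 0 = 0) ?comp0 //; apply/fps2P.
rewrite /= !scaler0 !addr0 -/(LVfactor a1 b1) -/(LVfactor a2 b2) -/Z -/W.
rewrite /is_normal_form !alongE !resonant_eq // !compX; try exact: ordge1.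
by split.
Qed.

End CenterManifold.

Theorem theorem4p2 (R : realType) (r : R)
    (a1 a2 a3 b1 b2 b3 c1 c2 c3 : R[i])
    (ha2 : a2 = b1^*) (hb2 : b2 = a1^*) (hc2 : c2 = c1^*)
    (hb3 : b3 = - a3^*) (hc3 : c3 = - c3^*) :
  let S := LV_system r a1 a2 a3 b1 b2 b3 c1 c2 c3 in
  (isochronous_center r S <->
     b1 * (a1 + a2) = 0 /\ a2 * (b1 + b2) = 0)
  /\
  (isochronous_center r S <->
     (b1 = 0 /\ b2 = 0) \/ (a1 = 0 /\ a2 = 0) \/
     (b1 = 0 /\ a2 = 0) \/ (a2 = - a1 /\ b1 = - b2)).
Proof.
move=> S.
have four : b1 * (a1 + a2) = 0 /\ a2 * (b1 + b2) = 0 <->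
    (b1 = 0 /\ b2 = 0) \/ (a1 = 0 /\ a2 = 0) \/
    (b1 = 0 /\ a2 = 0) \/ (a2 = - a1 /\ b1 = - b2).
  split=> [[/eqP + /eqP]|].
    rewrite !mulf_eq0 => /orP[/eqP b10|a12] /orP[/eqP a20|b12].
    - by right; right; left.
    - by left; split=> //; apply/eqP; move: b12; rewrite b10 add0r.
    - by right; left; split=> //; apply/eqP; move: a12; rewrite a20 addr0.
    - by do 3!right; split; apply/eqP; rewrite -addr_eq0 // addrC.
  case=> [[-> ->]|[[-> ->]|[[-> ->]|[-> ->]]]]; split; ring.
suff iso : isochronous_center r S <-> b1 * (a1 + a2) = 0 /\ a2 * (b1 + b2) = 0.
  by split=> //; rewrite iso.
rewrite /S isochronous_LVP; split.
  case=> xi [eta [lxi leta _ Dxi Deta]].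
  have lead (f g : fps2 R[i]) k j : ordge 2 (f - g) -> (k + j < 2)%N -> f k j = g k j.
    by move=> fg kj; apply/eqP; rewrite -subr_eq0 -coef2N -coef2D fg.
  split; [apply: LV_resonance_xi Dxi|apply: LV_resonance_eta Deta];
    by rewrite (lead _ _ _ _ lxi, lead _ _ _ _ leta).
(* Conjugacy makes [b1] and [a2] vanish together, so each of the first three conditions gives a
   decoupled system. *)
have b10 : b1 = 0 -> a2 = 0 by rewrite ha2 => ->; rewrite conjC0.
have a20 : a2 = 0 -> b1 = 0 by move=> /eqP; rewrite ha2 conjC_eq0 => /eqP.
move=> /four.
case=> [[b1_0 b2_0]|[[_ /a20 b1_0]|[[b1_0 _]|[-> ->]]]].
- by rewrite b1_0 b2_0 (b10 b1_0); apply: LV_linearization_decoupled.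
- by rewrite b1_0 (b10 b1_0); apply: LV_linearization_decoupled.
- by rewrite b1_0 (b10 b1_0); apply: LV_linearization_decoupled.
(* Here [b1] has been replaced by [- b2], so [opprK] restores [b2] in the second factor. *)
- by have := LV_linearization_projective a1 (- b2); rewrite opprK.
Qed.
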